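(* Let $\mathcal{D}$ be a $k$-linear triangulated category, let $\Omega\subset\mathbf{R}$ be a non-empty subspace, and let $F:\Omega\times\mathbf{R}\to\mathbf{R}$ be a continuous function. Then for every non-zero object $E$ of $\mathcal{D}$, the function $\Omega\times\mathrm{Stab}(\mathcal{D})\to\mathbf{R}$ defined by \[ (s,\sigma)\mapsto\int_{\mathbf{R}}F(s,\theta)\,\mathrm{d}m_{\sigma,E}(\theta) \] is continuous.
   Context: $k$ is a field and $\mathcal{D}$ is a $k$-linear triangulated category. A pre-stability condition $\sigma=(Z,\mathcal{P})$ on $\mathcal{D}$ consists of a group homomorphism $Z:K_0(\mathcal{D})\to\mathbf{C}$ and a slicing, i.e. a collection $\mathcal{P}=\{\mathcal{P}(\phi)\}_{\phi\in\mathbf{R}}$ of full additive subcategories of $\mathcal{D}$, such that: (a) $\mathrm{Hom}(\mathcal{P}(\phi),\mathcal{P}(\psi))=0$ if $\phi>\psi$; (b) $\mathcal{P}(\phi)[1]=\mathcal{P}(\phi+1)$; (c) every non-zero object $E$ has a Harder--Narasimhan (HN) filtration $0=E_0\to E_1\to\cdots\to E_n=E$ whose successive cones $G_i=\mathrm{Cone}(E_{i-1}\to E_i)$ (the HN factors, unique up to isomorphism) are non-zero objects of $\mathcal{P}(\phi_i)$ with $\phi_1>\cdots>\phi_n$; (d) $Z(E)\in\mathbf{R}_{>0}e^{i\pi\phi}$ for every non-zero $E\in\mathcal{P}(\phi)$. It is a stability condition if moreover each $\mathcal{P}(\phi)$ is a finite length abelian category. $\mathrm{Stab}(\mathcal{D})$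 is the set of stability conditions. For a non-zero object $E$ with HN factors $G_i\in\mathcal{P}(\phi_i)$, $i=1,\dots,n$: $\phi^+_\sigma(E)=\phi_1$, $\phi^-_\sigma(E)=\phi_n$, $m_\sigma(E)=\sum_i|Z(G_i)|$, and the mass measure is $\mathrm{d}m_{\sigma,E}=\sum_{i=1}^n|Z(G_i)|\,\delta_{\phi_i}$, where $\delta_x$ is the Dirac measure at $x$. $\mathrm{Stab}(\mathcal{D})$ carries the topology of the generalized metric \[ d(\sigma,\tau)=\sup_{0\ne E\in\mathcal{D}}\left\{|\phi^+_\sigma(E)-\phi^+_\tau(E)|,\ |\phi^-_\sigma(E)-\phi^-_\tau(E)|,\ \left|\log\tfrac{m_\tau(E)}{m_\sigma(E)}\right|\right\}. \] $\Omega\times\mathbf{R}$ and $\Omega\times\mathrm{Stab}(\mathcal{D})$ have the product topologies. *)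

(* Defs.v *)
From HB Require Import structures.
From mathcomp Require Import all_boot all_order all_algebra.
From mathcomp Require Import all_classical all_reals all_analysis.
From mathcomp Require Import complex freeg.

Set Implicit Arguments.
Unset Strict Implicit.
Unset Printing Implicit Defensive.
Set SsrOldRewriteGoalsOrder.

Import Order.TTheory GRing.Theory Num.Theory.
Import numFieldNormedType.Exports.

Local Open Scope classical_set_scope.
Local Open Scope ring_scope.

(* Hom spaces carry Leibniz equality; [cmp g f] is "g after f". *)
Record klinear_category (k : fieldType) := KLinearCategory {
  object :> Type;
  hom : object -> object -> lmodType k;
  idm : forall X, hom X X;
  cmp : forall X Y Z, hom Y Z -> hom X Y -> hom X Z;
  cmp1m : forall X Y (f : hom X Y), cmp (idm Y) f = f;
  cmpm1 : forall X Y (f : hom X Y), cmp f (idm X) = f;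
  cmpA : forall X Y Z W (h : hom Z W) (g : hom Y Z) (f : hom X Y),
    cmp h (cmp g f) = cmp (cmp h g) f;
  cmp_linearl : forall X Y Z (f : hom X Y),
    linear (fun g : hom Y Z => cmp g f);
  cmp_linearr : forall X Y Z (g : hom Y Z),
    linear (fun f : hom X Y => cmp g f) }.

Arguments idm {k C} X : rename.
Arguments cmp {k C X Y Z} g f : rename.
Notation "g \c f" := (cmp g f) (at level 40, left associativity).

Section Category.
Variables (k : fieldType) (C : klinear_category k).
Implicit Types X Y Z K : C.

Definition is_iso X Y (f : hom X Y) : Prop :=
  exists g : hom Y X, g \c f = idm X /\ f \c g = idm Y.

Definition isomorphic X Y : Prop := exists f : hom X Y, is_iso f.

(* Initial and terminal: a Hom space with a unique element is {0}. *)
Definition is_zero X : Prop :=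
  (forall Y (f : hom X Y), f = 0) /\ (forall Y (f : hom Y X), f = 0).

Definition is_biproduct X Y S (i1 : hom X S) (i2 : hom Y S)
    (p1 : hom S X) (p2 : hom S Y) : Prop :=
  [/\ p1 \c i1 = idm X, p2 \c i2 = idm Y, p1 \c i2 = 0, p2 \c i1 = 0
    & i1 \c p1 + i2 \c p2 = idm S].

Definition additive_category : Prop :=
  (exists X, is_zero X) /\
  (forall X Y, exists S (i1 : hom X S) (i2 : hom Y S)
     (p1 : hom S X) (p2 : hom S Y), is_biproduct i1 i2 p1 p2).

Definition is_mono X Y (f : hom X Y) : Prop :=
  forall W (u v : hom W X), f \c u = f \c v -> u = v.

Definition is_epi X Y (f : hom X Y) : Prop :=
  forall W (u v : hom Y W), u \c f = v \c f -> u = v.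

Definition is_kernel X Y (f : hom X Y) K (i : hom K X) : Prop :=
  f \c i = 0 /\
  forall W (u : hom W X), f \c u = 0 -> exists! v : hom W K, i \c v = u.

Definition is_cokernel X Y (f : hom X Y) K (p : hom Y K) : Prop :=
  p \c f = 0 /\
  forall W (u : hom Y W), u \c f = 0 -> exists! v : hom K W, v \c p = u.

Definition abelian_category : Prop :=
  [/\ additive_category,
      forall X Y (f : hom X Y), exists K (i : hom K X), is_kernel f i,
      forall X Y (f : hom X Y), exists K (p : hom Y K), is_cokernel f p,
      forall X Y (f : hom X Y), is_mono f ->
        exists Z (g : hom Y Z), is_kernel g f
    & forall X Y (f : hom X Y), is_epi f ->
        exists Z (g : hom Z X), is_cokernel g f].

Definition sub_le X S T (i : hom S X) (j : hom T X) : Prop :=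
  exists u : hom S T, j \c u = i.

Definition noetherian_category : Prop :=
  forall X (S : nat -> C) (i : forall n, hom (S n) X),
    (forall n, is_mono (i n)) -> (forall n, sub_le (i n) (i n.+1)) ->
    exists N, forall n, (N <= n)%N -> sub_le (i n.+1) (i n).

Definition artinian_category : Prop :=
  forall X (S : nat -> C) (i : forall n, hom (S n) X),
    (forall n, is_mono (i n)) -> (forall n, sub_le (i n.+1) (i n)) ->
    exists N, forall n, (N <= n)%N -> sub_le (i n) (i n.+1).

Definition finite_length_category : Prop :=
  noetherian_category /\ artinian_category.

Definition full_subcategory (A : C -> Prop) : klinear_category k :=
  @KLinearCategory k {X : C | A X}
    (fun x y => hom (sval x) (sval y))
    (fun x => idm (sval x))
    (fun x y z g f => g \c f)
    (fun x y f => cmp1m f)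
    (fun x y f => cmpm1 f)
    (fun x y z w h g f => cmpA h g f)
    (fun x y z f => @cmp_linearl k C _ _ (sval z) f)
    (fun x y z g => @cmp_linearr k C (sval x) _ _ g).

End Category.

(* The shift is an autoequivalence (not necessarily invertible on the nose). *)
Record triangulated_category (k : fieldType) := TriangulatedCategory {
  tri_cat :> klinear_category k;
  tri_additive : additive_category tri_cat;
  shift : tri_cat -> tri_cat;
  shiftm : forall X Y : tri_cat,
    {linear hom X Y -> hom (shift X) (shift Y)};
  shiftm1 : forall X : tri_cat, shiftm X X (idm X) = idm (shift X);
  shiftmM : forall (X Y Z : tri_cat) (g : hom Y Z) (f : hom X Y),
    shiftm X Z (g \c f) = shiftm Y Z g \c shiftm X Y f;
  shift_full_faithful : forall X Y : tri_cat, bijective (shiftm X Y);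
  shift_ess_surj : forall Y : tri_cat,
    exists X : tri_cat, isomorphic (shift X) Y;
  distinguished : forall X Y Z : tri_cat,
    hom X Y -> hom Y Z -> hom Z (shift X) -> Prop;
  tr_id : forall X O : tri_cat, is_zero O ->
    distinguished (idm X) (0 : hom X O) (0 : hom O (shift X));
  tr_iso : forall (X Y Z X' Y' Z' : tri_cat)
    (f : hom X Y) (g : hom Y Z) (h : hom Z (shift X))
    (f' : hom X' Y') (g' : hom Y' Z') (h' : hom Z' (shift X'))
    (a : hom X X') (b : hom Y Y') (c : hom Z Z'),
    is_iso a -> is_iso b -> is_iso c ->
    b \c f = f' \c a -> c \c g = g' \c b -> shiftm X X' a \c h = h' \c c ->
    distinguished f g h -> distinguished f' g' h';
  tr_cone : forall (X Y : tri_cat) (f : hom X Y),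
    exists (Z : tri_cat) (g : hom Y Z) (h : hom Z (shift X)),
      distinguished f g h;
  tr_rotate : forall (X Y Z : tri_cat)
    (f : hom X Y) (g : hom Y Z) (h : hom Z (shift X)),
    distinguished f g h <-> distinguished g h (- shiftm X Y f);
  tr_morph : forall (X Y Z X' Y' Z' : tri_cat)
    (f : hom X Y) (g : hom Y Z) (h : hom Z (shift X))
    (f' : hom X' Y') (g' : hom Y' Z') (h' : hom Z' (shift X'))
    (a : hom X X') (b : hom Y Y'),
    distinguished f g h -> distinguished f' g' h' -> b \c f = f' \c a ->
    exists c : hom Z Z', c \c g = g' \c b /\ shiftm X X' a \c h = h' \c c;
  (* octahedral axiom, with Z', Y', X' the cones of f, g \c f, g *)
  tr_octahedral : forall (X Y Z X' Y' Z' : tri_cat)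
    (f : hom X Y) (g : hom Y Z)
    (a : hom Y Z') (a' : hom Z' (shift X))
    (b : hom Z Y') (b' : hom Y' (shift X))
    (c : hom Z X') (c' : hom X' (shift Y)),
    distinguished f a a' -> distinguished (g \c f) b b' ->
    distinguished g c c' ->
    exists (u : hom Z' Y') (v : hom Y' X'),
      [/\ distinguished u v (shiftm Y Z' a \c c'),
          u \c a = b \c g, b' \c u = a', v \c b = c
        & c' \c v = shiftm X Y f \c b'] }.

Arguments shift {k D} X : rename.
Arguments distinguished {k D X Y Z} f g h : rename.

Section GrothendieckGroup.
Variables (k : fieldType) (D : triangulated_category k).

Definition free_group : zmodType := {freeg {classic D} / int}.

Definition free_class (E : D) : free_group := << (E : {classic D}) >>.

Inductive triangle_span : free_group -> Prop :=
| triangle_span0 : triangle_span 0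
| triangle_spanB x y :
    triangle_span x -> triangle_span y -> triangle_span (x - y)
| triangle_span_gen (X Y Z : D) (f : hom X Y) (g : hom Y Z)
    (h : hom Z (shift X)) :
    distinguished f g h ->
    triangle_span (free_class X - free_class Y + free_class Z).

Definition triangle_relations : {pred free_group} := fun x => `[< triangle_span x >].

Lemma triangle_relations_zmod : zmod_closed triangle_relations.
Proof.
split=> [|x y /asboolP hx /asboolP hy]; apply/asboolP;
  [exact: triangle_span0|exact: triangle_spanB].
Qed.

HB.instance Definition _ :=
  GRing.isZmodClosed.Build free_group triangle_relations triangle_relations_zmod.

Definition K0 : zmodType := @Quotient.quot free_group triangle_relations.

Definition K0_class (E : D) : K0 := (\pi_K0 (free_class E))%qT.

Lemma K0_class_triangle (X Y Z : D) (f : hom X Y) (g : hom Y Z)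
    (h : hom Z (shift X)) :
  distinguished f g h -> K0_class Y = K0_class X + K0_class Z.
Proof.
move=> fgh; rewrite /K0_class -[RHS]Quotient.pi_add; apply/eqP.
rewrite -Quotient.idealrBE; apply/asboolP.
have -> : free_class Y - (free_class X + free_class Z) =
    0 - (free_class X - free_class Y + free_class Z).
  by rewrite sub0r !opprD opprK addrCA addrA.
exact/triangle_spanB/triangle_span_gen/fgh/triangle_span0.
Qed.

End GrothendieckGroup.

Section Stability.
Variables (R : realType) (k : fieldType) (D : triangulated_category k).

(* HN_filtration P E [:: (phi_1, G_1); ...; (phi_n, G_n)]: there is a chain
   0 = E_0 -> E_1 -> ... -> E_n = E of cones G_i in P phi_i, with
   phi_1 > ... > phi_n. *)
Inductive HN_filtration (P : R -> D -> Prop) : D -> seq (R * D) -> Prop :=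
| HN_zero (E : D) : is_zero E -> HN_filtration P E [::]
| HN_step (E' E G : D) (phi : R) (s : seq (R * D))
    (f : hom E' E) (g : hom E G) (h : hom G (shift E')) :
    HN_filtration P E' s -> distinguished f g h ->
    ~ is_zero G -> P phi G -> all (fun p => phi < p.1) s ->
    HN_filtration P E (rcons s (phi, G)).

(* The subcategories P phi are taken strictly full (closed under isomorphism),
   so that P(phi)[1] is read as an essential image. *)
Record pre_stability := PreStability {
  charge : {additive K0 D -> R[i]};
  slice : R -> D -> Prop;
  slice_iso : forall phi (X Y : D),
    isomorphic X Y -> slice phi X -> slice phi Y;
  slice_additive : forall phi, additive_category (full_subcategory (slice phi));
  slice_hom : forall phi psi (X Y : D) (f : hom X Y),
    psi < phi -> slice phi X -> slice psi Y -> f = 0;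
  slice_shift : forall phi (X : D),
    slice (phi + 1) X <-> exists2 Y : D, slice phi Y & isomorphic (shift Y) X;
  slice_HN : forall E : D, ~ is_zero E ->
    exists s, HN_filtration slice E s;
  charge_slice : forall phi (E : D), ~ is_zero E -> slice phi E ->
    exists2 r : R, 0 < r &
      charge (K0_class E) = Complex (r * cos (pi * phi)) (r * sin (pi * phi)) }.

Record stability := Stability {
  stab_pre :> pre_stability;
  stab_finite_length : forall phi,
    abelian_category (full_subcategory (slice stab_pre phi)) /\
    finite_length_category (full_subcategory (slice stab_pre phi)) }.

Section HN.
Variable sigma : pre_stability.

(* A chosen HN filtration; its factors are unique up to isomorphism. *)
Definition HN_factors (E : D) : seq (R * D) :=
  if pselect (exists s, HN_filtration (slice sigma) E s) is left ex
  then sval (cid ex) else [::].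

Lemma HN_factorsP E : ~ is_zero E ->
  HN_filtration (slice sigma) E (HN_factors E).
Proof.
move=> /(slice_HN sigma) ex; rewrite /HN_factors.
by case: pselect => // ex'; exact: svalP (cid ex').
Qed.

Definition phase_max (E : D) : R := head 0 [seq p.1 | p <- HN_factors E].
Definition phase_min (E : D) : R := last 0 [seq p.1 | p <- HN_factors E].

Lemma normc_ge0 (z : R[i]) : 0 <= ComplexField.Normc.normc z.
Proof. by case: z => a b; exact: sqrtr_ge0. Qed.

Definition abs_charge (E : D) : {nonneg R} :=
  NngNum (normc_ge0 (charge sigma (K0_class E))).

Definition mass (E : D) : R := \sum_(p <- HN_factors E) (abs_charge p.2)%:num.

Definition atom (x : R) (w : {nonneg R}) :
  {measure set (measurableTypeR R) -> \bar R} :=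
  mscale w (\d_(x : measurableTypeR R)).

(* The default value of [nth] is never used. *)
Definition mass_measure (E : D) : {measure set (measurableTypeR R) -> \bar R} :=
  let atoms := [seq atom p.1 (abs_charge p.2) | p <- HN_factors E] in
  msum (nth (mzero : {measure set _ -> \bar R}) atoms) (size atoms).

Lemma HN_mass_gt0 E s : HN_filtration (slice sigma) E s -> ~ is_zero E ->
  0 < \sum_(p <- s) (abs_charge p.2)%:num.
Proof.
case=> [//|E' E0 G phi {}s f g h _ _ G0 PG _ _].
rewrite -cats1 big_cat big_seq1 ltr_wpDl ?sumr_ge0//.
have [r r0 Zr] := charge_slice G0 PG.
rewrite /abs_charge [X in _ < X]/= Zr /= Num.Theory.sqrtr_gt0 !exprMn -mulrDr cos2Dsin2 mulr1.
by rewrite exprn_gt0.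
Qed.

Lemma mass_gt0 E : ~ is_zero E -> 0 < mass E.
Proof. by move=> E0; exact: (HN_mass_gt0 (HN_factorsP E0)). Qed.

End HN.

Definition stab_dist (sigma tau : stability) : \bar R :=
  ereal_sup [set x | exists2 E : D, ~ is_zero E &
    [\/ x = `|phase_max sigma E - phase_max tau E|%:E,
        x = `|phase_min sigma E - phase_min tau E|%:E
      | x = `|ln (mass tau E / mass sigma E)|%:E]].

Definition stab_ball (sigma : stability) (e : R) : set stability :=
  [set tau | (stab_dist sigma tau < e%:E)%E].

Lemma stab_dist_sym sigma tau : stab_dist sigma tau = stab_dist tau sigma.
Proof.
suff H s t E : ~ is_zero E ->
    `|ln (mass t E / mass s E)| = `|ln (mass s E / mass t E)|.
  rewrite /stab_dist; congr ereal_sup; apply/seteqP.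
  by split=> x [E E0 /=]; rewrite (H _ _ _ E0) distrC (distrC (phase_min _ _));
    exists E.
move=> E0; rewrite -[mass t E / _]invrK invf_div lnV ?normrN//.
by rewrite posrE divr_gt0 ?mass_gt0.
Qed.

Lemma stab_dist_triangle sigma tau ups (a b : R) :
  (stab_dist sigma tau <= a%:E)%E -> (stab_dist tau ups <= b%:E)%E ->
  (stab_dist sigma ups <= (a + b)%:E)%E.
Proof.
have H s t E c : ~ is_zero E -> (stab_dist s t <= c%:E)%E ->
    [/\ `|phase_max s E - phase_max t E| <= c,
        `|phase_min s E - phase_min t E| <= c
      & `|ln (mass t E / mass s E)| <= c].
  by move=> E0 st; split; rewrite -lee_fin; apply: le_trans st;
    apply: ereal_sup_ubound; exists E => //;
    [exact: Or31|exact: Or32|exact: Or33].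
move=> sa sb; apply: ge_ereal_sup => x [E E0].
have [a1 a2 a3] := H _ _ _ _ E0 sa; have [b1 b2 b3] := H _ _ _ _ E0 sb.
case=> ->; rewrite lee_fin.
- rewrite -(subrKA (phase_max tau E)).
  by apply: le_trans (ler_normD _ _) _; exact: lerD.
- rewrite -(subrKA (phase_min tau E)).
  by apply: le_trans (ler_normD _ _) _; exact: lerD.
- have := mass_gt0 tau E0; have := mass_gt0 sigma E0; have := mass_gt0 ups E0.
  move=> u0 s0 t0; have -> : mass ups E / mass sigma E =
      (mass tau E / mass sigma E) * (mass ups E / mass tau E).
    by rewrite [RHS]mulrC mulrA divfK// gt_eqF.
  rewrite lnM ?posrE ?divr_gt0//.
  by apply: le_trans (ler_normD _ _) _; exact: lerD.
Qed.

Lemma stab_ball_center sigma (e : R) : 0 < e -> stab_ball sigma e sigma.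
Proof.
move=> e0; rewrite /stab_ball /=; apply: (@le_lt_trans _ _ 0%E); last first.
  by rewrite lte_fin.
apply: ge_ereal_sup => x [E E0]; have m0 := mass_gt0 sigma E0.
by case=> ->; rewrite ?subrr ?divff ?gt_eqF ?ln1 ?normr0.
Qed.

Lemma stab_ball_sym sigma tau (e : R) :
  stab_ball sigma e tau -> stab_ball tau e sigma.
Proof. by rewrite /stab_ball /= stab_dist_sym. Qed.

Lemma lt_EFin_le (x : \bar R) (e : R) : (x < e%:E)%E ->
  exists2 a : R, a < e & (x <= a%:E)%E.
Proof.
case: x => [r|//|_]; first by rewrite lte_fin => re; exists r.
by exists (e - 1); rewrite ?leNye// ltrBlDr ltrDl.
Qed.

Lemma stab_ball_triangle sigma tau ups (e1 e2 : R) :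
  stab_ball sigma e1 tau -> stab_ball tau e2 ups ->
  stab_ball sigma (e1 + e2) ups.
Proof.
move=> /lt_EFin_le [a ae sa] /lt_EFin_le [b be sb].
rewrite /stab_ball /=; apply: le_lt_trans (stab_dist_triangle sa sb) _.
by rewrite lte_fin ltrD.
Qed.

HB.instance Definition _ := gen_eqMixin stability.
HB.instance Definition _ := gen_choiceMixin stability.
HB.instance Definition _ := hasNbhs.Build stability (nbhs_ball_ stab_ball).

Lemma stab_nbhsE :
  nbhs = nbhs_ (entourage_ (stab_ball : stability -> R -> set stability)).
Proof.
apply/funext => sigma; apply/funext => A; apply/propext; split.
- move=> [e e0 eA]; exists [set xy | stab_ball xy.1 e xy.2]; first by exists e.
  by move=> y /xsectionP; exact: eA.
- move=> [B [e e0 eB] BA]; exists e => // y ye.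
  by apply: BA; apply/xsectionP; exact: eB.
Qed.

HB.instance Definition _ := Nbhs_isPseudoMetric.Build R stability stab_nbhsE
  stab_ball_center stab_ball_sym stab_ball_triangle erefl.

End Stability.

Arguments stability R {k} D.
Arguments pre_stability R {k} D.

(* Main.v *)
From mathcomp Require Import all_boot all_order all_algebra.
From mathcomp Require Import all_classical all_reals all_analysis.
From mathcomp Require Import complex.
Require Import Defs.

Set Implicit Arguments.
Unset Strict Implicit.
Unset Printing Implicit Defensive.

Import Order.TTheory GRing.Theory Num.Theory.
Import numFieldNormedType.Exports.

Local Open Scope classical_set_scope.
Local Open Scope ring_scope.

(* Let G_1, ..., G_n be the HN factors of E for sigma, with phases
   phi_1 > ... > phi_n. If tau is close to sigma, then the metric, applied to
   the objects G_i, forces the tau-HN factors of G_i to have phases close to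
   phi_i and total mass close to |Z(G_i)|. In particular the phases occurring
   in G_i are all larger than those occurring in G_(i+1), so the tau-HN
   filtrations of the G_i concatenate to the tau-HN filtration of E, which is
   unique. Hence the mass measure of E for tau is the sum of those of the G_i,
   each of which is concentrated near phi_i with nearly the same total mass
   |Z(G_i)|, and continuity follows from that of F at the points (s, phi_i). *)

(** * Composition, isomorphisms and zero objects in a linear category *)

Section Additivity.
Variables (k : fieldType) (C : klinear_category k).
Implicit Types X Y Z N : C.

Lemma cmpBl X Y Z (g g' : hom Y Z) (f : hom X Y) :
  (g - g') \c f = g \c f - g' \c f.
Proof.
by have := @cmp_linearl _ C _ _ _ f (-1) g' g;
  rewrite !scaleN1r ![- _ + _]addrC.
Qed.

Lemma cmpBr X Y Z (g : hom Y Z) (f f' : hom X Y) :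
  g \c (f - f') = g \c f - g \c f'.
Proof.
by have := @cmp_linearr _ C _ _ _ g (-1) f' f;
  rewrite !scaleN1r ![- _ + _]addrC.
Qed.

Lemma cmp0m X Y Z (f : hom X Y) : (0 : hom Y Z) \c f = 0.
Proof. by rewrite -[0 in LHS](subrr 0) cmpBl subrr. Qed.

Lemma cmpm0 X Y Z (g : hom Y Z) : g \c (0 : hom X Y) = 0.
Proof. by rewrite -[0 in LHS](subrr 0) cmpBr subrr. Qed.

Lemma cmpNm X Y Z (g : hom Y Z) (f : hom X Y) : (- g) \c f = - (g \c f).
Proof. by rewrite -[- g]sub0r cmpBl cmp0m sub0r. Qed.

Lemma cmpmN X Y Z (g : hom Y Z) (f : hom X Y) : g \c (- f) = - (g \c f).
Proof. by rewrite -[- f]sub0r cmpBr cmpm0 sub0r. Qed.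

Lemma is_iso_id X : is_iso (idm X).
Proof. by exists (idm X); rewrite cmp1m. Qed.

Lemma is_iso_opp_id X : is_iso (- idm X).
Proof. by exists (- idm X); rewrite cmpNm cmpmN cmp1m opprK. Qed.

Lemma is_iso_inv X Y (f : hom X Y) :
  is_iso f -> exists2 g : hom Y X, is_iso g & g \c f = idm X /\ f \c g = idm Y.
Proof. by case=> g [gf fg]; exists g => //; exists f. Qed.

Lemma is_zero_id0 X : idm X = 0 -> is_zero X.
Proof.
by move=> X0; split=> Y f; [rewrite -[f]cmpm1|rewrite -[f]cmp1m];
  rewrite X0 ?cmpm0 ?cmp0m.
Qed.

Lemma is_zero_iso X Y (f : hom X Y) : is_iso f -> is_zero X -> is_zero Y.
Proof.
move=> [g [_ fg]] [_ X0]; apply: is_zero_id0.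
by rewrite -fg (X0 _ g) cmpm0.
Qed.

End Additivity.

(** * Exactness, shifts and cocones of distinguished triangles *)

Section Triangles.
Variables (k : fieldType) (D : triangulated_category k).
Implicit Types X Y Z W N E G : D.

Lemma exists_zero : exists N : D, is_zero N.
Proof. by have [] := tri_additive D. Qed.

Lemma is_zero_shift N : is_zero N -> is_zero (shift N).
Proof.
case=> N0 _; apply: is_zero_id0.
by rewrite -shiftm1 (N0 _ (idm N)) linear0.
Qed.

Lemma shiftm_inj X Y : injective (shiftm X Y).
Proof. exact: bij_inj (shift_full_faithful X Y). Qed.

Lemma shiftm_surj X Y (f : hom (shift X) (shift Y)) :
  exists g : hom X Y, shiftm X Y g = f.
Proof. by have [h _ hK] := shift_full_faithful X Y; exists (h f). Qed.

Lemma tri_0id N W : is_zero N ->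
  distinguished (0 : hom N W) (idm W) (0 : hom W (shift N)).
Proof.
move=> N0; apply/tr_rotate; rewrite linear0 oppr0.
exact: tr_id (is_zero_shift N0).
Qed.

Section Triangle.
Variables (X Y Z : D) (f : hom X Y) (g : hom Y Z) (h : hom Z (shift X)).
Hypothesis fgh : distinguished f g h.

(** Exactness of Hom(W, -): [u] and a zero map start a morphism from the triangle on
    [W -> N -> shift W] to the rotation of [fgh]; its third component is the shift of the required
    lift. *)
Lemma tri_hom_lift W (u : hom W Y) : g \c u = 0 ->
  exists v : hom W X, f \c v = u.
Proof.
move=> gu0; have [N N0] := exists_zero.
have tW := (tr_rotate _ _ _).1 (tr_id W N0).
have gu : (0 : hom N Z) \c (0 : hom W N) = g \c u by rewrite cmp0m.
have [v' [_ vE]] := tr_morph tW ((tr_rotate _ _ _).1 fgh) gu.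
have [v vE0] := shiftm_surj v'; exists v; apply: shiftm_inj.
rewrite shiftmM vE0; apply: oppr_inj.
by rewrite -cmpNm -vE cmpmN shiftm1 cmpm1.
Qed.

(** Exactness of Hom(-, W), by mapping the triangle to [N -> W -> W] with [N] zero. *)
Lemma tri_hom_ext W (u : hom Y W) : u \c f = 0 ->
  exists v : hom Z W, v \c g = u.
Proof.
move=> uf0; have [N N0] := exists_zero.
have [|v [vg _]] := tr_morph (a := (0 : hom X N)) (b := u) fgh (tri_0id W N0).
  by rewrite uf0 cmp0m.
by exists v; rewrite vg cmp1m.
Qed.

(* Rotating three times negates all maps; the signs on the first two are
   removed by the automorphism -1 of the middle vertex. *)
Lemma tri_shift :
  distinguished (shiftm _ _ f) (shiftm _ _ g) (- shiftm _ _ h).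
Proof.
have := (tr_rotate _ _ _).1 ((tr_rotate _ _ _).1 ((tr_rotate _ _ _).1 fgh)).
apply: (@tr_iso _ _ _ _ _ _ _ _ _ _ _ _ _ _ (idm _) (- idm _) (idm _)).
- exact: is_iso_id.
- exact: is_iso_opp_id.
- exact: is_iso_id.
- by rewrite cmpNm cmpmN opprK cmp1m cmpm1.
- by rewrite cmp1m cmpmN cmpm1.
- by rewrite shiftm1 cmp1m cmpm1.
Qed.

End Triangle.

Lemma tri_unshift X Y Z (f : hom X Y) (g : hom Y Z) (h : hom Z (shift X)) :
  distinguished (shiftm _ _ f) (shiftm _ _ g) (- shiftm _ _ h) ->
  distinguished f g h.
Proof.
move=> fgh; do 3!apply/tr_rotate; move: fgh.
apply: (@tr_iso _ _ _ _ _ _ _ _ _ _ _ _ _ _ (idm _) (- idm _) (idm _)).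
- exact: is_iso_id.
- exact: is_iso_opp_id.
- exact: is_iso_id.
- by rewrite cmpNm cmp1m cmpm1.
- by rewrite cmp1m cmpNm cmpmN opprK cmpm1.
- by rewrite shiftm1 cmp1m cmpm1.
Qed.

Lemma tri_cocone Y Z (g : hom Y Z) :
  exists X (f : hom X Y) (h : hom Z (shift X)), distinguished f g h.
Proof.
have [Y0 [a [b gab]]] := tr_cone g.
have [X [i ii]] := shift_ess_surj Y0.
have [j ij [ji_ ij_]] := is_iso_inv ii.
(* The cone [Y0] has been desuspended to [X]; the sign cancels the one that [tr_rotate]
   introduces. *)
have [f fE] := shiftm_surj (- (b \c i)).
exists X, f, (j \c a); apply/tr_rotate; rewrite fE opprK.
apply: tr_iso gab; [exact: is_iso_id|exact: is_iso_id|exact: ij|..].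
- by rewrite cmp1m cmpm1.
- by rewrite cmpm1.
- by rewrite shiftm1 cmp1m -cmpA ij_ cmpm1.
Qed.

Lemma tri_zero_iso X Y N (f : hom X Y) (g : hom Y N) (h : hom N (shift X)) :
  is_zero N -> distinguished f g h -> is_iso f.
Proof.
move=> N0 fgh.
have [v fv] : exists v, f \c v = idm Y.
  by apply: (tri_hom_lift fgh); exact: N0.2.
exists v; split => //; apply/eqP; rewrite -subr_eq0; apply/eqP.
(* Since [f] kills [v \c f - idm X], the shift of this difference factors through [h], whose source
   [N] is zero. *)
apply: shiftm_inj; rewrite linear0.
have [|w wE] := tri_hom_lift ((tr_rotate _ _ _).1 ((tr_rotate _ _ _).1 fgh))
  (u := shiftm _ _ (v \c f - idm X)).
  by rewrite cmpNm -shiftmM cmpBr cmpA fv cmp1m cmpm1 subrr linear0 oppr0.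
by rewrite -wE (N0.1 _ h) cmp0m.
Qed.

Lemma K0_class_zero N : is_zero N -> K0_class N = 0.
Proof.
move=> N0; have := K0_class_triangle (tr_id N N0).
by rewrite -[LHS]addr0 => /addrI ->.
Qed.

Lemma K0_class_iso X Y (f : hom X Y) : is_iso f -> K0_class X = K0_class Y.
Proof.
move=> fi; have [N N0] := exists_zero.
have fO : distinguished f (0 : hom Y N) (0 : hom N (shift X)).
  apply: tr_iso (tr_id X N0); [exact: is_iso_id|exact: fi|exact: is_iso_id|..].
  - by rewrite !cmpm1.
  - by rewrite cmpm0 cmp0m.
  - by rewrite cmpm0 cmp0m.
by rewrite (K0_class_triangle fO) (K0_class_zero N0) addr0.
Qed.

Lemma tri_iso_middle X Y Y' Z (f : hom X Y) (g : hom Y Z) (h : hom Z (shift X))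
    (i : hom Y Y') : distinguished f g h -> is_iso i ->
  exists (f' : hom X Y') (g' : hom Y' Z), distinguished f' g' h.
Proof.
move=> fgh ii; have [j ij [ji_ ij_]] := is_iso_inv ii.
exists (i \c f), (g \c j).
apply: tr_iso fgh; [exact: is_iso_id|exact: ii|exact: is_iso_id|..].
- by rewrite cmpm1.
- by rewrite cmp1m -cmpA ji_ cmpm1.
- by rewrite shiftm1 cmp1m cmpm1.
Qed.

(** [E''] acts as the preimage of [G'] in [E]. The octahedral axiom for [g' \c g], on rotated
    triangles with cones [shift E'], [shift E''] and [shift G'], gives the first triangle up to a
    shift. *)
Lemma tri_pull E' E G G' H (f : hom E' E) (g : hom E G) (h : hom G (shift E'))
    (f' : hom G' G) (g' : hom G H) (h' : hom H (shift G')) :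
  distinguished f g h -> distinguished f' g' h' ->
  exists (E'' : D) (a : hom E' E'') (b : hom E'' G') (c : hom G' (shift E'))
    (d : hom E'' E) (e : hom H (shift E'')),
    distinguished a b c /\ distinguished d (g' \c g) e.
Proof.
move=> fgh fgh'; have [E'' [d [e de]]] := tri_cocone (g' \c g).
have [u [v [uv _ _ _ _]]] := tr_octahedral
  ((tr_rotate _ _ _).1 fgh) ((tr_rotate _ _ _).1 de) ((tr_rotate _ _ _).1 fgh').
have [a aE] := shiftm_surj u; have [b bE] := shiftm_surj v.
have [c cE] := shiftm_surj (- (shiftm _ _ h \c - shiftm _ _ f')).
exists E'', a, b, c, d, e; split => //; apply: tri_unshift.
by rewrite aE bE cE opprK.
Qed.

End Triangles.

(* The Hom vanishing makes comparison maps between two truncations of the same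
   object both exist and be unique. *)
Lemma tri_truncation_unique (k : fieldType) (D : triangulated_category k)
    (E E1 G1 E2 G2 : D)
    (f1 : hom E1 E) (g1 : hom E G1) (h1 : hom G1 (shift E1))
    (f2 : hom E2 E) (g2 : hom E G2) (h2 : hom G2 (shift E2)) :
  distinguished f1 g1 h1 -> distinguished f2 g2 h2 ->
  (forall u : hom E1 G2, u = 0) -> (forall u : hom E2 G1, u = 0) ->
  (forall u : hom (shift E1) G1, u = 0) ->
  (forall u : hom (shift E2) G2, u = 0) ->
  isomorphic E1 E2 /\ isomorphic G1 G2.
Proof.
move=> fgh1 fgh2 hom12 hom21 hom1 hom2.
have [a fa] := tri_hom_lift fgh2 (hom12 (g2 \c f1)).
have [b fb] := tri_hom_lift fgh1 (hom21 (g1 \c f2)).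
have [c cg] := tri_hom_ext fgh1 (hom12 (g2 \c f1)).
have [d dg] := tri_hom_ext fgh2 (hom21 (g1 \c f2)).
have sub_id (E1' G : D) (f : hom E1' E) (g : hom E G) h :
    distinguished f g h -> (forall u : hom (shift E1') G, u = 0) ->
    (forall u : hom E1' E1', f \c u = f -> u = idm E1') /\
    (forall u : hom G G, u \c g = g -> u = idm G).
  move=> fgh homG; split=> u fu; apply/eqP; rewrite -subr_eq0; apply/eqP.
    apply: shiftm_inj; rewrite linear0.
    have rrfgh := (tr_rotate _ _ _).1 ((tr_rotate _ _ _).1 fgh).
    have [|w <-] := tri_hom_lift rrfgh (u := shiftm _ _ (u - idm _)).
      by rewrite cmpNm -shiftmM cmpBr fu cmpm1 subrr linear0 oppr0.
    by rewrite (homG w) cmpm0.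
  have [|w <-] := tri_hom_ext ((tr_rotate _ _ _).1 fgh) (u := u - idm _).
    by rewrite cmpBl fu cmp1m subrr.
  by rewrite (homG w) cmp0m.
have [idE1 idG1] := sub_id _ _ _ _ _ fgh1 hom1.
have [idE2 idG2] := sub_id _ _ _ _ _ fgh2 hom2.
split; [exists a; exists b|exists c; exists d]; split.
- by apply: idE1; rewrite cmpA fb fa.
- by apply: idE2; rewrite cmpA fa fb.
- by apply: idG1; rewrite -cmpA cg dg.
- by apply: idG2; rewrite -cmpA dg cg.
Qed.

(** * Concatenation and uniqueness of HN filtrations *)

Section HNFiltrations.
Variables (R : realType) (k : fieldType) (D : triangulated_category k).
Implicit Types (X Y E F G H : D) (P : R -> D -> Prop) (s t : seq (R * D)).

Lemma HN_inv P E s : HN_filtration P E s ->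
  (s = [::] /\ is_zero E) \/
  exists E' G phi s' (f : hom E' E) (g : hom E G) (h : hom G (shift E')),
    [/\ HN_filtration P E' s', distinguished f g h, ~ is_zero G, P phi G
      & all (fun p => phi < p.1) s'] /\ s = rcons s' (phi, G).
Proof.
case=> [X X0|E' X G phi s' f g h E's fgh G0 PG phis]; first by left.
by right; exists E', G, phi, s', f, g, h.
Qed.

Lemma HN_iso P X Y s : isomorphic X Y ->
  HN_filtration P X s -> HN_filtration P Y s.
Proof.
move=> [i ii] /HN_inv[[-> X0]|].
  by apply: HN_zero; exact: is_zero_iso ii X0.
move=> [E' [G [phi [s' [f [g [h [[E's fgh G0 PG phis] ->]]]]]]]].
have [f' [g' fgh']] := tri_iso_middle fgh ii.
exact: HN_step E's fgh' G0 PG phis.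
Qed.

Lemma HN_semistable P G phi : ~ is_zero G -> P phi G ->
  HN_filtration P G [:: (phi, G)].
Proof.
move=> G0 PG; have [N N0] := exists_zero D.
exact: HN_step (HN_zero P N0) (tri_0id G N0) G0 PG _.
Qed.

(* Octahedral axiom, peeling off the factors of G from the bottom phase up. *)
Lemma HN_cat P E' E G s t (f : hom E' E) (g : hom E G) (h : hom G (shift E')) :
  distinguished f g h -> HN_filtration P E' s -> HN_filtration P G t ->
  allrel (fun p q => q.1 < p.1) s t ->
  HN_filtration P E (s ++ t).
Proof.
move=> fgh E's Gt; elim: Gt E f g h fgh => {G t}
  [G G0 E f g h fgh _|G' G H phi t f' g' h' G't IH fgh' H0 PH phit E f g h fgh].
  by rewrite cats0; apply: HN_iso E's; exists f; exact: tri_zero_iso G0 fgh.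
rewrite -cats1 allrel_catr => /andP[st sphi].
have [E'' [a [b [c [d [e [abc de]]]]]]] := tri_pull fgh fgh'.
rewrite cats1 -rcons_cat; apply: (HN_step (IH _ _ _ _ abc st) de H0 PH).
rewrite all_cat phit andbT; apply: sub_all sphi => p.
by rewrite /= andbT.
Qed.

Lemma HN_sorted P E s : HN_filtration P E s ->
  sorted (fun x y => y < x) [seq p.1 | p <- s].
Proof.
elim=> [//|E' {}E G phi {}s f g h _ IH _ _ _ phis].
rewrite map_rcons; case: s IH phis => //= p s IH /andP[pphi phis].
rewrite rcons_path IH /=.
have: all (fun p => phi < p) (p.1 :: [seq p.1 | p <- s]).
  by rewrite /= pphi all_map.
by move=> /allP; apply; exact: mem_last.
Qed.

Lemma HN_phase_le P E s : HN_filtration P E s ->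
  all (fun p => p.1 <= head 0 [seq p.1 | p <- s]) s.
Proof.
move=> /HN_sorted; case: s => //= p s; rewrite lexx /= path_map => ps.
apply: sub_all (order_path_min _ ps) => [q /ltW //|x y z] /=.
by move=> yx zy; exact: lt_trans zy yx.
Qed.

Lemma HN_phase_ge P E s : HN_filtration P E s ->
  all (fun p => last 0 [seq p.1 | p <- s] <= p.1) s.
Proof.
move=> /HN_inv[[->//]|].
move=> [E' [G [phi [s' [f [g [h [[_ _ _ _ phis] ->]]]]]]]].
rewrite map_rcons last_rcons all_rcons lexx /=.
by apply: sub_all phis => p /ltW.
Qed.

Section Unique.
Variable sigma : pre_stability R D.
Let P := slice sigma.

(** Devissage: once a map vanishes on [E'] it factors through [G], where the Hom vanishing between
    slices applies. *)
Lemma HN_hom0 E s phi X (u : hom E X) : HN_filtration P E s -> P phi X ->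
  all (fun p => phi < p.1) s -> u = 0.
Proof.
move=> Es PX; elim: Es u => [{}E E0 u _|]; first exact: E0.1.
move=> E' {}E G psi {}s f g h _ IH fgh _ PG _ u.
rewrite all_rcons => /andP[/= phipsi /IH E'0].
have [v <-] := tri_hom_ext fgh (E'0 (u \c f)).
by rewrite (slice_hom v phipsi PG PX) cmp0m.
Qed.

(** The same devissage on shifted triangles, as the shift only raises phases. This is the vanishing
    behind the uniqueness of comparison maps between truncations. *)
Lemma HN_shift_hom0 E s phi X (u : hom (shift E) X) :
  HN_filtration P E s -> P phi X -> all (fun p => phi < p.1) s -> u = 0.
Proof.
move=> Es PX; elim: Es u => [{}E E0 u _|].
  exact: (is_zero_shift E0).1.
move=> E' {}E G psi {}s f g h _ IH fgh _ PG _ u.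
rewrite all_rcons => /andP[/= phipsi /IH E'0].
have [v <-] := tri_hom_ext (tri_shift fgh) (E'0 (u \c shiftm _ _ f)).
have PG1 : P (psi + 1) (shift G).
  apply/slice_shift; exists G => //; exists (idm _); exact: is_iso_id.
by rewrite (slice_hom v _ PG1 PX) ?cmp0m// (lt_trans phipsi)// ltrDl.
Qed.

(** If [g] were zero, [idm G] would factor through [h] and a map [shift E' -> G], which vanishes for
    phase reasons. *)
Lemma HN_quotient_neq0 E' E G s phi
    (f : hom E' E) (g : hom E G) (h : hom G (shift E')) :
  HN_filtration P E' s -> distinguished f g h -> ~ is_zero G -> P phi G ->
  all (fun p => phi < p.1) s -> g <> 0.
Proof.
move=> E's fgh G0 PG phis g0; apply: G0; apply: is_zero_id0.
have [|w <-] := tri_hom_ext ((tr_rotate _ _ _).1 fgh) (u := idm G).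
  by rewrite g0 cmpm0.
by rewrite (HN_shift_hom0 w E's PG phis) cmp0m.
Qed.

(** Phases and classes suffice, since a mass sees a factor only through its charge. Induction strips
    the lowest factor: its phase is forced, and then [tri_truncation_unique] identifies both
    pieces. *)
Lemma HN_unique E s t : HN_filtration P E s -> HN_filtration P E t ->
  [seq (p.1, K0_class p.2) | p <- s] = [seq (p.1, K0_class p.2) | p <- t].
Proof.
move=> Es; elim: Es t => {E s} [E E0 t|].
  move=> /HN_inv[[-> //]|].
  move=> [E' [G [phi [s' [f [g [h [[E's fgh G0 PG phis] _]]]]]]]].
  by case: (HN_quotient_neq0 E's fgh G0 PG phis); exact: E0.1.
move=> E' E G phi s f g h E's IH fgh G0 PG phis t /HN_inv[[_ E0]|].
  by case: (HN_quotient_neq0 E's fgh G0 PG phis); exact: E0.1.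
move=> [F [H [psi [t' [f' [g' [h' [[Ft' fgh' H0 PH psit] ->]]]]]]]].
(* If [phi2 < phi1], all factors of the first filtration have phase above [phi2], so [g2] vanishes,
   against [HN_quotient_neq0]. By symmetry the lowest phases agree. *)
have cmp_phase E1 G1 phi1 s1 (f1 : hom E1 E) (g1 : hom E G1) h1
    E2 G2 phi2 s2 (f2 : hom E2 E) (g2 : hom E G2) h2 :
    HN_filtration P E1 s1 -> distinguished f1 g1 h1 -> ~ is_zero G1 ->
    P phi1 G1 -> all (fun p => phi1 < p.1) s1 ->
    HN_filtration P E2 s2 -> distinguished f2 g2 h2 -> ~ is_zero G2 ->
    P phi2 G2 -> all (fun p => phi2 < p.1) s2 -> phi1 <= phi2.
  move=> E1s t1 G10 P1 a1 E2s t2 G20 P2 a2; rewrite leNgt; apply/negP => lt12.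
  apply: (HN_quotient_neq0 E2s t2 G20 P2 a2).
  apply: HN_hom0 (HN_step E1s t1 G10 P1 a1) P2 _.
  by rewrite all_rcons lt12; apply: sub_all a1 => p; exact: lt_trans.
have eqphi : phi = psi.
  apply/le_anti/andP; split.
    exact: (cmp_phase _ _ _ _ _ _ _ _ _ _ _ _ _ _ E's fgh G0 PG phis Ft' fgh').
  exact: (cmp_phase _ _ _ _ _ _ _ _ _ _ _ _ _ _ Ft' fgh' H0 PH psit E's fgh).
subst psi.
have [||||E'F [i ii]] := tri_truncation_unique fgh fgh'.
- by move=> u; exact: HN_hom0 E's PH phis.
- by move=> u; exact: HN_hom0 Ft' PG psit.
- by move=> u; exact: HN_shift_hom0 E's PG phis.
- by move=> u; exact: HN_shift_hom0 Ft' PH psit.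
rewrite !map_rcons /= (K0_class_iso ii); congr rcons.
apply: IH; apply: HN_iso Ft'; case: E'F => a [b [ba ab]].
by exists b, a.
Qed.

End Unique.
End HNFiltrations.

(** * Integrals against the mass measure as finite sums *)

Section MassMeasure.
Variables (R : realType) (k : fieldType) (D : triangulated_category k).
Variable sigma : pre_stability R D.
Implicit Types (E G : D) (s : seq (R * D)) (f : R -> R).

(** The integral of [f] against the atoms given by [s]; a free list allows filtrations other than
    the chosen [HN_factors]. *)
Definition HN_sum f s : R :=
  \sum_(p <- s) (abs_charge sigma p.2)%:num * f p.1.

Lemma massE E : mass sigma E = HN_sum (fun=> 1) (HN_factors sigma E).
Proof. by apply: eq_bigr => p _; rewrite mulr1. Qed.

Lemma HN_sum_unique f E s t : HN_filtration (slice sigma) E s ->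
  HN_filtration (slice sigma) E t -> HN_sum f s = HN_sum f t.
Proof.
move=> Es Et.
have HN_sumE r : HN_sum f r =
    \sum_(q <- [seq (p.1, K0_class p.2) | p <- r])
      ComplexField.Normc.normc (charge sigma q.2) * f q.1.
  by rewrite big_map.
by rewrite !HN_sumE (HN_unique Es Et).
Qed.

Lemma HN_phases_unique E s t : HN_filtration (slice sigma) E s ->
  HN_filtration (slice sigma) E t -> [seq p.1 | p <- s] = [seq p.1 | p <- t].
Proof.
move=> Es Et; have /(congr1 (map fst)) := HN_unique Es Et.
by rewrite -!map_comp.
Qed.

Lemma HN_factors_bounds E : ~ is_zero E ->
  all (fun q => phase_min sigma E <= q.1 <= phase_max sigma E)
    (HN_factors sigma E).
Proof.
move=> /(HN_factorsP sigma) Es; rewrite (all_predI (fun q => _ <= q.1)).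
by rewrite (HN_phase_ge Es) (HN_phase_le Es).
Qed.

Lemma HN_sum_norm_le f s (d : R) : all (fun q => `|f q.1| <= d) s ->
  `|HN_sum f s| <= HN_sum (fun=> d) s.
Proof.
rewrite /HN_sum; elim: s => [_|q s IH /= /andP[fq /IH]].
  by rewrite !big_nil normr0.
rewrite !big_cons => fs; apply: le_trans (ler_normD _ _) _; apply: lerD fs.
rewrite normrM ger0_norm ?normc_ge0//; apply: ler_wpM2l => //.
exact: normc_ge0.
Qed.

Section Semistable.
Variables (G : D) (phi : R).
Hypotheses (G0 : ~ is_zero G) (PG : slice sigma phi G).

Lemma phase_max_semistable : phase_max sigma G = phi.
Proof.
rewrite /phase_max.
by rewrite (HN_phases_unique (HN_factorsP sigma G0) (HN_semistable G0 PG)).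
Qed.

Lemma phase_min_semistable : phase_min sigma G = phi.
Proof.
rewrite /phase_min.
by rewrite (HN_phases_unique (HN_factorsP sigma G0) (HN_semistable G0 PG)).
Qed.

Lemma mass_semistable : mass sigma G = (abs_charge sigma G)%:num.
Proof.
rewrite massE (HN_sum_unique _ (HN_factorsP sigma G0) (HN_semistable G0 PG)).
by rewrite /HN_sum big_seq1 mulr1.
Qed.

End Semistable.

Lemma Rintegral_mass_measure f E : continuous f ->
  \int[mass_measure sigma E]_x f x = HN_sum f (HN_factors sigma E).
Proof.
move=> cf; rewrite /Rintegral /mass_measure.
set s := HN_factors sigma E.
have mf : measurable_fun [set: measurableTypeR R] f.
  exact: measurable_realfun.continuous_measurable_fun.
(* Non-negative integrands come first, evaluated atom by atom; [f] is then split into its positive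
   and negative parts. *)
have ge0 (g : R -> R) : (forall x, 0 <= g x) ->
    measurable_fun [set: measurableTypeR R] g ->
    (\int[msum (nth (mzero : {measure set _ -> \bar R})
        [seq atom p.1 (abs_charge sigma p.2) | p <- s])
      (size [seq atom p.1 (abs_charge sigma p.2) | p <- s])]_x (g x)%:E)%E
    = (HN_sum g s)%:E.
  move=> g0 /measurable_realfun.measurable_EFinP mg.
  rewrite ge0_integral_measure_sum//; last first.
    by move=> x _; rewrite lee_fin.
  rewrite size_map /HN_sum (big_nth (0, E)) big_mkord -sumEFin.
  (* The default [(0, E)] is never reached, as [i] stays below the length of [s]. *)
  apply: eq_bigr => i _; rewrite (nth_map (0, E))//.
  rewrite ge0_integral_mscale//; last by move=> x _; rewrite lee_fin.
  rewrite integral_dirac// diracT mul1e.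
  by rewrite EFinM.
rewrite integralE funerpos funerneg.
rewrite !ge0; [|exact: funrneg_ge0|exact: measurable_realfun.measurable_funrneg
  |exact: funrpos_ge0|exact: measurable_realfun.measurable_funrpos].
rewrite -EFinB /= /HN_sum -sumrB; apply: eq_bigr => p _.
by rewrite -mulrBr -[in RHS](funrposBneg f).
Qed.

End MassMeasure.

(** * Continuity of extremal phases and mass *)

Section Continuity.
Variables (R : realType) (k : fieldType) (D : triangulated_category k).
Implicit Types (sigma tau : stability R D) (E G : D).

Lemma stab_ball_bounds sigma tau E e : ~ is_zero E -> stab_ball sigma e tau ->
  [/\ `|phase_max sigma E - phase_max tau E| < e,
      `|phase_min sigma E - phase_min tau E| < e
    & `|ln (mass tau E / mass sigma E)| < e].
Proof.
by move=> E0 st; split; rewrite -lte_fin; apply: le_lt_trans st;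
  apply: ereal_sup_ubound; exists E => //;
  [exact: Or31|exact: Or32|exact: Or33].
Qed.

Lemma phase_max_continuous E : ~ is_zero E ->
  continuous (fun sigma : stability R D => phase_max sigma E).
Proof.
move=> E0 sigma; apply/(cvgrPdist_lt (F := nbhs sigma)) => e e0.
by exists e => // tau /(stab_ball_bounds E0)[].
Qed.

Lemma phase_min_continuous E : ~ is_zero E ->
  continuous (fun sigma : stability R D => phase_min sigma E).
Proof.
move=> E0 sigma; apply/(cvgrPdist_lt (F := nbhs sigma)) => e e0.
by exists e => // tau /(stab_ball_bounds E0)[].
Qed.

(** The metric controls the logarithm of the mass ratio, so the mass is [mass sigma E] times the
    exponential of a function tending to 0. *)
Lemma mass_continuous E : ~ is_zero E ->
  continuous (fun sigma : stability R D => mass sigma E).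
Proof.
move=> E0 sigma.
have cln : (fun tau : stability R D => ln (mass tau E / mass sigma E)) @ sigma
    --> (0 : R).
  apply/(cvgrPdist_lt (F := nbhs sigma)) => e e0.
  by exists e => // tau /(stab_ball_bounds E0)[_ _]; rewrite sub0r normrN.
have mE (tau : stability R D) :
    mass sigma E * expR (ln (mass tau E / mass sigma E)) = mass tau E.
  have s0 := mass_gt0 sigma E0.
  by rewrite lnK ?posrE ?divr_gt0 ?mass_gt0// mulrC divfK// gt_eqF.
rewrite /continuous_at -[X in _ --> X]mulr1 -expR0 -(funext mE).
apply: (cvgM (F := nbhs sigma)).
  exact: (@cvg_cst _ _ _ (nbhs sigma)).
exact: cvg_comp cln (@continuous_expR R 0).
Qed.

End Continuity.

(** * Continuity of the integral *)

Section Main.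
Variables (R : realType) (k : fieldType) (D : triangulated_category k).
Variables (T : topologicalType) (F : T * R -> R).
Hypothesis F_cont : continuous F.
Implicit Types (E G : D).
Local Notation TS := (T * stability R D)%type.

(** Both extremal phases of [G] are continuous and equal [phi] at [sigma], which squeezes all nearby
    factors towards [phi]. The window from [a] to [b] serves the concatenation in [HN_near]. *)
Lemma semistable_near (x : T) (sigma : stability R D) G (phi a b e : R) :
  ~ is_zero G -> slice sigma phi G -> a < phi < b -> 0 < e ->
  {near (x, sigma), forall p : TS,
    all (fun q => a < q.1 < b) (HN_factors p.2 G) /\
    `|HN_sum p.2 (fun theta => F (p.1, theta)) (HN_factors p.2 G)
      - (abs_charge sigma G)%:num * F (x, phi)| < e}.
Proof.
move=> G0 PG /andP[aphi phib] e0.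
have w0 : 0 <= (abs_charge sigma G)%:num by [].
set w := (abs_charge sigma G)%:num in w0 *.
have w1 : 0 < w + 1 by rewrite ltr_wpDl.
have e20 : 0 < e / 2 by rewrite divr_gt0.
(* This tolerance on [F] gets multiplied by a mass below [w + 1], giving at most [e / 2]. *)
have d0 : 0 < e / 2 / (w + 1) by rewrite divr_gt0.
have snd_cont (f : stability R D -> R) : continuous f ->
    (fun p : TS => f p.2) @ (x, sigma) --> f sigma.
  move=> cf; apply: (@cvg_comp TS _ _ snd f _ (nbhs sigma)); last exact: cf.
  exact: cvg_snd.
have [[A B] /= [xA /nbhs_ballP[r /= r0 rB]] AB] :=
  cvgr_dist_lt _ _ (@F_cont (x, phi)) _ d0.
have cmax := snd_cont _ (phase_max_continuous G0).
have cmin := snd_cont _ (phase_min_continuous G0).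
have cmass := snd_cont _ (mass_continuous G0).
rewrite (phase_max_semistable G0 PG) in cmax.
rewrite (phase_min_semistable G0 PG) in cmin.
rewrite (mass_semistable G0 PG) -/w in cmass.
have cmassF : (fun p : TS => mass p.2 G * F (x, phi)) @ (x, sigma) -->
    w * F (x, phi) by apply: cvgM; [exact: cmass|exact: cvg_cst].
near=> p.
have pA : A p.1.
  near: p; exact: cvg_fst.
have max_b : phase_max p.2 G < b by near: p; exact: cvgr_lt cmax _ phib.
have min_a : a < phase_min p.2 G by near: p; exact: cvgr_gt cmin _ aphi.
have max_r : phase_max p.2 G < phi + r.
  by near: p; apply: cvgr_lt cmax _ _; rewrite ltrDl.
have min_r : phi - r < phase_min p.2 G.
  by near: p; apply: cvgr_gt cmin _ _; rewrite gtrBl.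
have mass_w : mass p.2 G < w + 1.
  by near: p; apply: cvgr_lt cmass _ _; rewrite ltrDl.
have massF : `|mass p.2 G * F (x, phi) - w * F (x, phi)| < e / 2.
  by rewrite distrC; near: p; apply: (cvgr_dist_lt _ _ cmassF).
have bounds := HN_factors_bounds p.2 G0; split.
  apply: sub_all bounds => q /andP[minq qmax].
  by rewrite (lt_le_trans min_a minq) (le_lt_trans qmax max_b).
(* The error splits into the mass-weighted variation of [F] around [(x, phi)] and the change of mass
   times [F (x, phi)]. *)
rewrite [ltLHS](_ : _ = `|HN_sum p.2 (fun theta => F (p.1, theta) - F (x, phi))
    (HN_factors p.2 G) + (mass p.2 G * F (x, phi) - w * F (x, phi))|);
  last first.
  rewrite addrA; congr (`|_ - _|); rewrite /mass mulr_suml -big_split/=.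
  by apply: eq_bigr => q _; rewrite mulrBr subrK.
rewrite [e]splitr; apply: le_lt_trans (ler_normD _ _) _.
apply: ler_ltD massF.
apply: (@le_trans _ _ (mass p.2 G * (e / 2 / (w + 1)))); last first.
  by rewrite mulrA ler_pdivrMr// mulrC ler_pM2l// ltW.
rewrite /mass mulr_suml.
apply: HN_sum_norm_le; apply: sub_all bounds => q /andP[minq qmax].
rewrite distrC; apply: ltW; apply: (AB (p.1, q.1)); split => //=.
apply: rB; rewrite /ball /= ltr_distlC; apply/andP; split.
  exact: lt_le_trans min_r minq.
exact: le_lt_trans qmax max_r.
Unshelve. all: by end_near. Qed.

(** The bound [c] makes the induction close: used for [E'] with a bound [b] above [phi], it keeps
    the factors of [E'] above those of [G], so that [HN_cat] applies. *)
Lemma HN_near (x : T) (sigma : stability R D) E s (c e : R) :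
  HN_filtration (slice sigma) E s -> all (fun q => c < q.1) s -> 0 < e ->
  {near (x, sigma), forall p : TS, exists2 t,
    HN_filtration (slice p.2) E t /\ all (fun q => c < q.1) t &
    `|HN_sum p.2 (fun theta => F (p.1, theta)) t
      - HN_sum sigma (fun theta => F (x, theta)) s| < e}.
Proof.
move=> Es; elim: Es c e => {E s} [E E0|
  E' E G phi s f g h E's IH fgh G0 PG phis] c e cs e0.
  near=> p; exists [::]; first by split => //; exact: HN_zero.
  by rewrite /HN_sum !big_nil subrr normr0.
move: cs; rewrite all_rcons => /andP[/= cphi cs].
(* [b] separates [phi] from the finitely many higher phases: a minimum of midpoints, starting from
   [phi + 1] for empty [s]. *)
have [b phib bs] : exists2 b, phi < b & all (fun q => b < q.1) s.
  elim: s phis {E's IH cs} => [_|q s IHs /= /andP[phiq /IHs[b phib bs]]].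
    by exists (phi + 1) => //; rewrite ltrDl.
  exists (Num.min b ((phi + q.1) / 2)).
    by rewrite lt_min phib midf_lt.
  rewrite gt_min midf_lt ?orbT//=; apply: sub_all bs => q' bq'.
  by rewrite gt_min bq'.
have e20 : 0 < e / 2 by rewrite divr_gt0.
have cphib : c < phi < b by rewrite cphi.
near=> p.
have [t [E't bt] tsum] : exists2 t,
    HN_filtration (slice p.2) E' t /\ all (fun q => b < q.1) t &
    `|HN_sum p.2 (fun theta => F (p.1, theta)) t
      - HN_sum sigma (fun theta => F (x, theta)) s| < e / 2.
  by near: p; exact: IH.
have [Gcb Gsum] : all (fun q => c < q.1 < b) (HN_factors p.2 G) /\
    `|HN_sum p.2 (fun theta => F (p.1, theta)) (HN_factors p.2 G)
      - (abs_charge sigma G)%:num * F (x, phi)| < e / 2.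
  by near: p; exact: semistable_near.
exists (t ++ HN_factors p.2 G).
  split.
    apply: (HN_cat fgh E't (HN_factorsP p.2 G0)).
    apply: sub_all bt => q bq; apply: sub_all Gcb => q' /andP[_ q'b].
    exact: lt_trans q'b bq.
  rewrite all_cat; apply/andP; split.
    by apply: sub_all bt => q; apply: lt_trans; exact: lt_trans phib.
  by apply: sub_all Gcb => q /andP[].
rewrite /HN_sum big_cat -cats1 big_cat big_seq1 /= opprD addrACA [e]splitr.
by apply: le_lt_trans (ler_normD _ _) _; exact: ltrD.
Unshelve. all: by end_near. Qed.

End Main.

Theorem theorem1 (R : realType) (k : fieldType) (D : triangulated_category k)
    (Omega : set R) (Omega_neq0 : Omega !=set0)
    (F : Omega * R -> R) (F_cont : continuous F)
    (E : D) (E_neq0 : ~ is_zero E) :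
  continuous (fun p : Omega * stability R D =>
    \int[mass_measure p.2 E]_theta F (p.1, theta)).
Proof.
have int_sum (p : Omega * stability R D) :
    \int[mass_measure p.2 E]_theta F (p.1, theta) =
    HN_sum p.2 (fun theta => F (p.1, theta)) (HN_factors p.2 E).
  apply: Rintegral_mass_measure => theta.
  apply: continuous_comp; last exact: F_cont.
  apply: (cvg_pair (F := nbhs theta) (G := nbhs p.1) (H := nbhs theta)
    (f := fun=> p.1) (g := id)); [exact: cvg_cst|exact: cvg_id].
move=> [x sigma]; apply/cvgrPdist_lt => e e0.
have Es := HN_factorsP sigma E_neq0.
(* Any number below the lowest phase can start the induction of [HN_near]. *)
have [c cs] : exists c, all (fun q => c < q.1) (HN_factors sigma E).
  exists (phase_min sigma E - 1); apply: sub_all (HN_phase_ge Es) => q.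
  by apply: lt_le_trans; rewrite gtrBl.
near=> p.
have [t [Et _] tsum] : exists2 t,
    HN_filtration (slice p.2) E t /\ all (fun q => c < q.1) t &
    `|HN_sum p.2 (fun theta => F (p.1, theta)) t
      - HN_sum sigma (fun theta => F (x, theta)) (HN_factors sigma E)| < e.
  by near: p; exact: HN_near.
(* Uniqueness trades the chosen filtration for the concatenated one [t]. *)
rewrite !int_sum distrC (HN_sum_unique _ (HN_factorsP p.2 E_neq0) Et).
exact: tsum.
Unshelve. all: by end_near. Qed.
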